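(* Let $n\in\mathbb{N}$, $n>2$. Then for every computable abelian group $G$ and every $b\in G$, $b\neq 0$, there is a computable $n$-coloring $c$ of $G$ with no monochromatic solutions to $x-y=b$.
   Context: A computable group is a group whose underlying set and group operations are computable. An $n$-coloring of $G$ is any map $c:G\to n=\{0,\dots,n-1\}$. A monochromatic solution (for $c$) of $x-y=b$ is a pair $(x,y)\in G^2$ with $x-y=b$ and $c(x)=c(y)$. *)

(* Defs.v *)
From HB Require Import structures.
From mathcomp Require Import all_boot all_order all_algebra.

Set Implicit Arguments.
Unset Strict Implicit.
Unset Printing Implicit Defensive.

Import GRing.Theory.
Local Open Scope ring_scope.

(** Partial recursive functions of fixed arity.  [prim f g] defines
    [h(0, v) = f v] and [h(i+1, v) = g (i, h(i, v), v)]; [mu f] maps [v] to the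
    least [i] such that [f (i, v) = 0], all [f (j, v)] with [j < i] being
    defined and nonzero. *)
Inductive recfun : nat -> Type :=
| rzero k : recfun k
| rsucc : recfun 1
| rproj k (i : 'I_k) : recfun k
| rcomp k m (f : recfun m) (g : 'I_m -> recfun k) : recfun k
| rprim k (f : recfun k) (g : recfun k.+2) : recfun k.+1
| rmu k (f : recfun k.+1) : recfun k.

(** [reval e v y]: the computation of [e] on [v] converges to [y].  In the
    primitive recursion case, [w] lists the intermediate values. *)
Fixpoint reval k (e : recfun k) : k.-tuple nat -> nat -> Prop :=
  match e in recfun k return k.-tuple nat -> nat -> Prop with
  | rzero _ => fun v y => y = 0%N
  | rsucc => fun v y => y = (thead v).+1
  | rproj _ i => fun v y => y = tnth v i
  | rcomp _ m f g => fun v y =>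
      exists2 w : m.-tuple nat,
        forall i, reval (g i) v (tnth w i) & reval f w y
  | rprim _ f g => fun v y =>
      exists w : nat -> nat,
        [/\ reval f [tuple of behead v] (w 0%N),
            forall i, (i < thead v)%N ->
              reval g [tuple of i :: w i :: behead v] (w i.+1)
          & y = w (thead v)]
  | rmu _ f => fun v y =>
      reval f [tuple of y :: v] 0%N /\
      forall i, (i < y)%N -> exists z, reval f [tuple of i :: v] z.+1
  end.

(** Computability of functions between types whose elements are represented by
    natural numbers through [i] and [j]. *)
Definition computable1 (T U : Type) (i : T -> nat) (j : U -> nat)
    (f : T -> U) : Prop :=
  exists e : recfun 1, forall x, reval e [tuple i x] (j (f x)).

Definition computable2 (T U : Type) (i : T -> nat) (j : U -> nat)
    (f : T -> T -> U) : Prop :=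
  exists e : recfun 2, forall x y, reval e [tuple i x; i y] (j (f x y)).

(** Abelian groups, written additively, whose underlying set is a subset of
    the natural numbers. *)
Record natZmod := NatZmod {
  nz_dom : pred nat;
  nz_isZmodule : GRing.isZmodule {x : nat | nz_dom x}
}.

Definition natZmod_zmodType (G : natZmod) : zmodType :=
  HB.pack {x : nat | nz_dom G x} (nz_isZmodule G).
Coercion natZmod_zmodType : natZmod >-> zmodType.

Definition nz_val (G : natZmod) (x : G) : nat :=
  val (x : {x : nat | nz_dom G x}).

Definition computable_group (G : natZmod) : Prop :=
  [/\ computable1 (@id nat) nat_of_bool (nz_dom G),
      computable2 (@nz_val G) (@nz_val G) (fun x y => x + y)
    & computable1 (@nz_val G) (@nz_val G) (fun x => - x)].

Definition computable_coloring (G : natZmod) (n : nat) (c : G -> 'I_n) : Prop :=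
  computable1 (@nz_val G) (@nat_of_ord n) c.

Definition mono_solution (G : zmodType) (n : nat) (c : G -> 'I_n) (b x y : G) :
    Prop :=
  x - y = b /\ c x = c y.

(* Main.v *)
Require Import Defs.
From HB Require Import structures.
From mathcomp Require Import all_boot all_order all_algebra.

Set Implicit Arguments.
Unset Strict Implicit.
Unset Printing Implicit Defensive.

Import GRing.Theory.
Local Open Scope ring_scope.

(** Walk from [x] by steps of [b], as long as the elements, read as natural
    numbers, decrease; do the same with steps of [-b].  If both walks are
    nonempty then [x] is a local maximum of its [b]-orbit and gets colour [2];
    otherwise [x] gets the parity of the length of the nonempty walk.  Two
    neighbours are never both local maxima, and if neither is one, then their
    walks go in the same direction and their lengths differ by one. *)

(** * Closure properties of total recursive functions *)

Definition recursive k (F : k.-tuple nat -> nat) : Prop :=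
  exists e : recfun k, forall v, reval e v (F v).

Lemma eq_recursive k (F H : k.-tuple nat -> nat) :
  F =1 H -> recursive F -> recursive H.
Proof. by move=> eqFH [e eP]; exists e => v; rewrite -eqFH. Qed.

Lemma recursive_tnth k (i : 'I_k) : recursive (fun v => tnth v i).
Proof. by exists (rproj i). Qed.

Lemma recursive_comp k m (F : m.-tuple nat -> nat)
    (g : 'I_m -> k.-tuple nat -> nat) :
  recursive F -> (forall i, recursive (g i)) ->
  recursive (fun v => F [tuple g i v | i < m]).
Proof.
move=> [e eP] /fin_all_exists[d dP]; exists (rcomp e d) => v /=.
by exists [tuple g i v | i < m] => // i; rewrite tnth_mktuple.
Qed.

Lemma recursive_comp1 k (F : nat -> nat) (g : k.-tuple nat -> nat) :
  recursive (fun v : 1.-tuple nat => F (thead v)) -> recursive g ->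
  recursive (fun v => F (g v)).
Proof.
move=> Frec grec.
apply: eq_recursive (recursive_comp (g := fun=> g) Frec _) => // v.
by rewrite /thead tnth_mktuple.
Qed.

Lemma recursive_behead k (F : k.-tuple nat -> nat) :
  recursive F -> recursive (fun v : k.+1.-tuple nat => F [tuple of behead v]).
Proof.
move=> Frec; apply: eq_recursive
  (recursive_comp Frec (fun i => recursive_tnth (lift ord0 i))) => v.
congr F; apply: eq_from_tnth => i; rewrite tnth_mktuple tnth_behead.
by congr tnth; apply: val_inj; rewrite /= inordK ?ltnS.
Qed.

Lemma recursive_succ k (f : k.-tuple nat -> nat) :
  recursive f -> recursive (fun v => (f v).+1).
Proof. by apply: (recursive_comp1 (F := S)); exists rsucc. Qed.

Lemma recursive_const k n : recursive (fun _ : k.-tuple nat => n).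
Proof. by elim: n => [|n /recursive_succ //]; exists (rzero k). Qed.

(** Primitive recursion with a computed counter: [rprim] recurses on the first entry of its input,
    so it is composed with the tuple [a v :: v]. *)
Lemma recursive_nat_rect k (a f : k.-tuple nat -> nat)
    (g : nat -> nat -> k.-tuple nat -> nat) :
  recursive a -> recursive f ->
  recursive (fun u : k.+2.-tuple nat =>
    g (thead u) (thead [tuple of behead u]) [tuple of behead (behead u)]) ->
  recursive (fun v => nat_rect (fun=> nat) (f v) (fun i r => g i r v) (a v)).
Proof.
move=> arec [e eP] [d dP].
have prec : recursive (fun u : k.+1.-tuple nat =>
    nat_rect (fun=> nat) (f [tuple of behead u])
      (fun i r => g i r [tuple of behead u]) (thead u)).
  exists (rprim e d) => u /=.
  exists (nat_rect (fun=> nat) (f [tuple of behead u])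
      (fun i r => g i r [tuple of behead u])); split=> // i _ /=.
  set w := [tuple of _ :: _]; have := dP w.
  by congr (reval _ _ (g _ _ _)); apply: val_inj.
pose h (i : 'I_k.+1) (v : k.-tuple nat) := tnth [tuple of a v :: v] i.
have hrec i : recursive (h i).
  have [j|] := unliftP ord0 i => ->.
    by apply: eq_recursive (recursive_tnth j) => v; rewrite /h tnthS.
  by apply: eq_recursive arec => v; rewrite /h tnth0.
apply: eq_recursive (recursive_comp prec hrec) => v.
have -> : [tuple h i v | i < k.+1] = [tuple of a v :: v].
  by apply: eq_from_tnth => i; rewrite tnth_mktuple.
by have -> : [tuple of behead [tuple of a v :: v]] = v by apply: val_inj.
Qed.

Lemma recursive_mu k (F : k.+1.-tuple nat -> nat) (h : k.-tuple nat -> nat) :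
  recursive F -> (forall v, F [tuple of h v :: v] = 0%N) ->
  (forall v i, (i < h v)%N -> (0 < F [tuple of i :: v])%N) -> recursive h.
Proof.
move=> [e eP] h0 hmin; exists (rmu e) => v /=; split; first by rewrite -(h0 v).
move=> i /hmin Fgt0; exists (F [tuple of i :: v]).-1.
by rewrite prednK.
Qed.

(** A boolean counts as 0 or 1, so a case distinction is a recursion of at most one step, with base
    [g] and step [f]. *)
Lemma recursive_if k (c : k.-tuple nat -> bool) (f g : k.-tuple nat -> nat) :
  recursive c -> recursive f -> recursive g ->
  recursive (fun v => if c v then f v else g v).
Proof.
move=> crec frec grec; apply: eq_recursive (recursive_nat_rect
  (g := fun _ _ => f) crec grec (recursive_behead (recursive_behead frec))) => v.
by case: (c v).
Qed.

Lemma recursive_iter k (F : nat -> nat) (a f : k.-tuple nat -> nat) :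
  recursive (fun v : 1.-tuple nat => F (thead v)) -> recursive a ->
  recursive f -> recursive (fun v => iter (a v) F (f v)).
Proof.
move=> Frec arec frec; apply: eq_recursive (recursive_nat_rect
  (g := fun _ r _ => F r) arec frec
  (recursive_comp1 Frec (recursive_behead (recursive_tnth ord0)))) => v.
by elim: (a v) => //= n ->.
Qed.

Lemma recursive_pred k (f : k.-tuple nat -> nat) :
  recursive f -> recursive (fun v => (f v).-1).
Proof.
move=> frec.
have := recursive_nat_rect (g := fun i _ _ => i) frec (recursive_const k 0)
  (recursive_tnth ord0).
by apply: eq_recursive => v; case: (f v).
Qed.

Lemma recursive_subn k (f g : k.-tuple nat -> nat) :
  recursive f -> recursive g -> recursive (fun v => f v - g v)%N.
Proof.
move=> frec grec.
have := recursive_iter (recursive_pred (recursive_tnth ord0)) grec frec.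
by apply: eq_recursive => v; elim: (g v) => [|n /= ->]; rewrite ?subn0 ?subnS.
Qed.

Lemma recursive_odd k (f : k.-tuple nat -> nat) :
  recursive f -> recursive (fun v => odd (f v)).
Proof.
move=> frec.
(* Parity arises by iterating [r] to [1 - r], starting at 0. *)
have := recursive_iter
  (recursive_subn (recursive_const 1 1) (recursive_tnth ord0)) frec
  (recursive_const k 0).
by apply: eq_recursive => v; elim: (f v) => //= n ->; case: odd.
Qed.

Lemma recursive_gt0 k (f : k.-tuple nat -> nat) :
  recursive f -> recursive (fun v => (0 < f v)%N).
Proof.
move=> frec; have := recursive_subn (recursive_const k 1)
  (recursive_subn (recursive_const k 1) frec).
by apply: eq_recursive => v; case: (f v).
Qed.

(** * Lengths of descending walks and the colouring *)

Lemma iter_nondecreasing_ex (f : nat -> nat) x :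
  exists t, (iter t f x <= iter t.+1 f x)%N.
Proof.
elim/ltn_ind: x => x IHx; have [le_x_fx|/IHx[t le_t]] := leqP x (f x).
  by exists 0%N.
by exists t.+1; rewrite !(iterSr _ f x).
Qed.

Definition descent (f : nat -> nat) x := ex_minn (iter_nondecreasing_ex f x).

Lemma descent_nondecreasing (f : nat -> nat) x :
  (x <= f x)%N -> descent f x = 0%N.
Proof.
move=> le_x_fx; rewrite /descent; case: ex_minnP => t _ /(_ 0%N le_x_fx).
by rewrite leqn0 => /eqP.
Qed.

(** The walk from [x] is one step followed by the walk from [f x]; minimality of each stopping time
    bounds the other. *)
Lemma descent_decreasing (f : nat -> nat) x :
  (f x < x)%N -> descent f x = (descent f (f x)).+1.
Proof.
move=> lt_fx_x; rewrite /descent.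
case: ex_minnP => -[|t] /= Pt tmin; first by rewrite leqNgt lt_fx_x in Pt.
case: ex_minnP => s Ps smin; congr _.+1; apply/eqP; rewrite eqn_leq.
rewrite -ltnS tmin /=; last by rewrite -!iterSr in Ps.
by apply: smin; rewrite /= -!iterSr.
Qed.

Lemma recursive_descent (f : nat -> nat) :
  recursive (fun v : 1.-tuple nat => f (thead v)) ->
  recursive (fun v : 1.-tuple nat => descent f (thead v)).
Proof.
move=> frec.
have t1 := recursive_tnth (ord0 : 'I_2).
have t2 := recursive_tnth (ord_max : 'I_2).
(* The truncated difference of two consecutive iterates vanishes exactly when the walk fails to
   decrease, so [descent] is its least zero. *)
apply: recursive_mu (recursive_subn (recursive_iter frec t1 t2)
  (recursive_iter frec (recursive_succ t1) t2)) _ _ => [v|v i];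
  case/tupleP: v => x v; rewrite theadE /descent; case: ex_minnP => t Pt tmin.
  by apply/eqP; rewrite subn_eq0.
by rewrite subn_gt0 ltnNge => /(contra (tmin i)); rewrite -ltnNge.
Qed.

(** If both walks are empty, the last branch gives colour 0. *)
Definition descent_color (f g : nat -> nat) x : nat :=
  if (0 < descent f x)%N then
    if (0 < descent g x)%N then 2%N else odd (descent f x)
  else odd (descent g x).

Lemma descent_color_lt3 f g x : (descent_color f g x < 3)%N.
Proof. by rewrite /descent_color; do 2?case: ifP => _ //; case: odd. Qed.

(** By this symmetry, one lemma on neighbours serves both directions of descent. *)
Lemma descent_colorC f g x : descent_color f g x = descent_color g f x.
Proof.
by rewrite /descent_color; case: (descent f x) (descent g x) => [|a] [|c].
Qed.

Lemma recursive_descent_color f g :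
  recursive (fun v : 1.-tuple nat => f (thead v)) ->
  recursive (fun v : 1.-tuple nat => g (thead v)) ->
  recursive (fun v : 1.-tuple nat => descent_color f g (thead v)).
Proof.
move=> /recursive_descent frec /recursive_descent grec.
exact: recursive_if (recursive_gt0 frec) (recursive_if (recursive_gt0 grec)
  (recursive_const _ 2) (recursive_odd frec)) (recursive_odd grec).
Qed.

(** The [g]-walk from [f x] is empty, as [g] leads back up to [x]. So [f x] gets the parity of its
    [f]-walk, while [x] gets 2 or the opposite parity. *)
Lemma descent_color_neq f g x :
  (f x < x)%N -> g (f x) = x -> descent_color f g (f x) != descent_color f g x.
Proof.
move=> lt_fx_x gfx; have dg0 : descent g (f x) = 0%N.
  by apply: descent_nondecreasing; rewrite gfx ltnW.
rewrite /descent_color dg0 [descent f x]descent_decreasing //=.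
by case: (descent f (f x)) => [|a]; case: (descent g x) => [|c] //=; case: odd.
Qed.

(** * Translation by a fixed element, on codes *)

Section Shift.

Variable G : natZmod.

Definition nz_insub (m : nat) : G := insubd ((0 : G) : {x : nat | nz_dom G x}) m.

(* Outside the domain, the group operations of a computable group may diverge;
   sending such numbers to [0] makes the shift a total recursive function. *)
Definition nat_shift (b : G) (m : nat) : nat := nz_val (nz_insub m + b).

Lemma nz_valK : cancel (@nz_val G) nz_insub.
Proof. exact: valKd. Qed.

Lemma nat_shiftE b (x : G) : nat_shift b (nz_val x) = nz_val (x + b).
Proof. by rewrite /nat_shift nz_valK. Qed.

Lemma recursive_nat_shift b : computable_group G ->
  recursive (fun v : 1.-tuple nat => nat_shift b (thead v)).
Proof.
move=> [[d dP] [e eP] _].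
have drec : recursive (fun v : 1.-tuple nat => nz_dom G (thead v)).
  exists d => v; rewrite [v in reval _ v](_ : v = [tuple thead v]) //.
  by case/tupleP: v => x v; rewrite (tuple0 v); apply: val_inj.
have [r rP] : recursive (fun v : 1.-tuple nat => nz_val (nz_insub (thead v))).
  apply: eq_recursive
    (recursive_if drec (recursive_tnth ord0) (recursive_const 1 (nz_val (0 : G)))).
  by move=> v; rewrite /nz_val /nz_insub val_insubd.
have [c cP] := recursive_const 1 (nz_val b).
(* The addition program [e] is only known to converge on codes of elements, so the composite is
   built by hand, with [r] first replacing its input by such a code. *)
exists (rcomp e (fun i : 'I_2 => if i == ord0 then r else c)) => v /=.
exists [tuple nz_val (nz_insub (thead v)); nz_val b]; last exact: eP.
by move=> i; have [j|] := unliftP ord0 i => -> //=; rewrite (ord1 j).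
Qed.

End Shift.

Theorem proposition3p0p8 (n : nat) (hn : (2 < n)%N) (G : natZmod)
    (hG : computable_group G) (b : G) (hb : b <> 0) :
  exists c : G -> 'I_n,
    computable_coloring c /\ ~ exists x y : G, mono_solution c b x y.
Proof.
pose f := nat_shift b; pose g := nat_shift (- b).
(* Only the colours 0, 1 and 2 occur, and they lie below [n]. *)
exists (fun x => Ordinal (leq_trans (descent_color_lt3 f g (nz_val x)) hn)).
split.
  have [e eP] := recursive_descent_color (recursive_nat_shift b hG)
    (recursive_nat_shift (- b) hG).
  by exists e => x; apply: eP.
move=> [x [y [xyb /(congr1 val)/= eq_xy]]].
have fy : f (nz_val y) = nz_val x by rewrite /f nat_shiftE -xyb addrC subrK.
have gx : g (nz_val x) = nz_val y.
  by rewrite /g nat_shiftE -xyb opprB addrC subrK.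
(* The larger code descends to the smaller: from [y] by [f], or from [x] by [g]. Equal codes would
   force [b = 0]. *)
have [lt_xy|lt_yx|/val_inj eqxy] := ltngtP (nz_val x) (nz_val y).
- have := @descent_color_neq f g (nz_val y).
  by rewrite fy gx eq_xy eqxx => /(_ lt_xy erefl).
- have := @descent_color_neq g f (nz_val x).
  by rewrite gx fy !(descent_colorC g) eq_xy eqxx => /(_ lt_yx erefl).
- by apply: hb; rewrite -xyb eqxy subrr.
Qed.
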